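(* Let $\mathsf V=(\mathsf V,\otimes,\mathsf k)$ be a completely distributive quantale. Let $\iota:\mathsf 2=\{\bot<\top\}\to\mathsf V$ be given by $\iota(\bot)=\bot$, $\iota(\top)=\mathsf k$; let $\pi:\mathsf V\to\mathsf 2$ be its right adjoint, $\pi(v)=\top\iff v\ge\mathsf k$. Then $B_\iota$ embeds the category $\mathbf{Top}$ of topological spaces and continuous maps into $\mathsf V\text{-}\mathbf{App}$ as a full coreflective subcategory, with coreflector $B_\pi$. If $\mathsf V$ is integral (i.e. $\mathsf k=\top$), the embedding is also reflective, with reflector $\overline B_o$, where $o:\mathsf V\to\mathsf 2$ is the left adjoint of $\iota$, $o(v)=\bot\iff v=\bot$. In particular, $\mathbf{Top}$ is both reflective and coreflective in the category $\mathbf{App}=[0,\infty]\text{-}\mathbf{App}$ of approach spaces, as well as in the category $\mathbf{ProbApp}=\mathbf\Delta\text{-}\mathbf{App}$ of probabilistic approach spaces.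
   Context: A quantale $\mathsf V=(\mathsf V,\otimes,\mathsf k)$ is a complete lattice with a (not necessarily commutative) monoid structure whose operation $\otimes$ preserves arbitrary suprema in each variable. $\mathsf 2$ is a quantale with $\otimes=\wedge$. $[0,\infty]$ is a quantale with lattice order the reverse of the natural order, $\otimes=+$, neutral element $0$. $\mathbf\Delta$ is the quantale of all $\varphi:[0,\infty]\to[0,1]$ with $\varphi(\beta)=\sup_{\alpha<\beta}\varphi(\alpha)$ for all $\beta$, ordered pointwise, with $(\varphi\odot\psi)(\gamma)=\sup_{\alpha+\beta\le\gamma}\varphi(\alpha)\psi(\beta)$ and neutral element $\kappa$ ($\kappa(0)=0$, $\kappa(\alpha)=1$ for $\alpha>0$). $\mathsf V\text{-}\mathbf{App}$ has as objects ($\mathsf V$-approach spaces) sets $X$ with a map $c:\mathsf PX\to\mathsf V^X$ ($\mathsf PX$ the power set of $X$) such that, for all $x,z\in X$, $A,B\subseteq X$, $\mathcal A\subseteq\mathsf PX$: $\mathsf k\le c(\{x\})(x)$; $\big(\bigwedge_{y\in B}\bigvee_{A\in\mathcal A}(cA)(y)\big)\otimes (cB)(z)\le c(\bigcup\mathcal A)(z)$; $(c\emptyset)(x)=\bot$; $c(A\cup B)(x)=(cA)(x)\vee(cB)(x)$. Morphisms $f:(X,c)\to(Y,d)$ are maps with $(cA)(x)\le(df(A))(f(x))$ for all $A\subseteq X$, $x\in X$. For $\mathsf V$ completely distributive, $\mathsf V\text{-}\mathbf{App}$ is isomorphic to the category $(\beta,\mathsf V)\text{-}\mathbf{Alg}$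 and is identified with it here, via $(\ell\mathfrak x)(x)=\bigwedge_{A\in\mathfrak x}(cA)(x)$ and $(cA)(x)=\bigvee_{\mathfrak x\ni A}(\ell\mathfrak x)(x)$. The objects of $(\beta,\mathsf V)\text{-}\mathbf{Alg}$ are sets $X$ with $\ell:\mathsf UX\to\mathsf V^X$ ($\mathsf UX$ the set of ultrafilters on $X$) such that $\mathsf k\le\ell(\dot x)(x)$ and $\big(\bigwedge_{\mathcal A\in\mathfrak X,\,B\in\mathfrak y}\bigvee_{\mathfrak x\in\mathcal A,\,y\in B}(\ell\mathfrak x)(y)\big)\otimes(\ell\mathfrak y)(z)\le\ell(\Sigma_X\mathfrak X)(z)$ for all $x,z\in X$, $\mathfrak y\in\mathsf UX$, $\mathfrak X\in\mathsf U\mathsf UX$, where $\dot x$ is the principal ultrafilter at $x$ and $A\in\Sigma_X\mathfrak X\iff\{\mathfrak x\in\mathsf UX: A\in\mathfrak x\}\in\mathfrak X$; morphisms $f:(X,\ell)\to(Y,\ell')$ are maps with $(\ell\mathfrak x)(y)\le(\ell'f[\mathfrak x])(f(y))$, where $f[\mathfrak x]=\{B: f^{-1}B\in\mathfrak x\}$. For $\mathsf V=\mathsf 2$ this is $\mathbf{Top}$, with $(\ell\mathfrak x)(x)=\top$ iff $\mathfrak x$ converges to $x$ (and $c$ the closure operation). For a monotone map $\theta:\mathsf V\to\mathsf W$ of quantales, $B_\theta(X,\ell)=(X,\ell_\theta)$ with $(\ell_\theta\mathfrak x)(x)=\theta((\ell\mathfrak x)(x))$, and $\overline B_\theta(X,\ell)$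 is $X$ with the least $(\beta,\mathsf W)$-algebra structure $\ell'$ (pointwise order) such that $\theta((\ell\mathfrak x)(x))\le(\ell'\mathfrak x)(x)$ for all $\mathfrak x,x$; both are identical on underlying maps.
   Formalization: The formal theorem additionally assumes k ≠ ⊥ (V has more than one element); for the one-element quantale V-App is Set and B_ι is the forgetful functor, which is not full, so the statement fails there. *)

(* Defs.v *)
From HB Require Import structures.
From mathcomp Require Import all_boot all_order all_algebra.
From mathcomp Require Import boolp classical_sets functions set_interval reals.
From mathcomp Require Import constructive_ereal ereal filter topology.

Set Implicit Arguments.
Unset Strict Implicit.
Unset Printing Implicit Defensive.
Import Order.TTheory GRing.Theory Num.Theory.
Local Open Scope classical_set_scope.
Local Obligation Tactic := idtac.

Record category := Category {
  obj :> Type;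
  hom : obj -> obj -> Type;
  idm : forall A, hom A A;
  cmp : forall A B C, hom B C -> hom A B -> hom A C;
  cmp1m : forall A B (f : hom A B), cmp (idm B) f = f;
  cmpm1 : forall A B (f : hom A B), cmp f (idm A) = f;
  cmpA : forall A B C D (h : hom C D) (g : hom B C) (f : hom A B),
    cmp h (cmp g f) = cmp (cmp h g) f }.

Arguments hom {c} A B.
Arguments idm {c} A.
Arguments cmp {c A B C} g f.

Record functor (C D : category) := Functor {
  fobj :> C -> D;
  fhom : forall A B : C, hom A B -> hom (fobj A) (fobj B);
  fhom1 : forall A : C, fhom (idm A) = idm (fobj A);
  fhomM : forall (A A' A'' : C) (g : hom A' A'') (f : hom A A'),
    fhom (cmp g f) = cmp (fhom g) (fhom f) }.

Arguments fhom {C D} F {A B} f : rename.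

Program Definition fcomp (C D E : category) (G : functor D E)
    (F : functor C D) : functor C E :=
  {| fobj := fun A => G (F A); fhom := fun A B f => fhom G (fhom F f) |}.
Next Obligation. by move=> * /=; rewrite !fhom1. Qed.
Next Obligation. by move=> * /=; rewrite !fhomM. Qed.

Definition full (C D : category) (F : functor C D) :=
  forall (A B : C) (g : hom (F A) (F B)), exists f : hom A B, fhom F f = g.

Definition embedding (C D : category) (F : functor C D) :=
  injective (fobj F) /\ forall A B : C, injective (@fhom _ _ F A B).

Definition left_adjoint (C D : category) (F : functor C D)
    (G : functor D C) : Prop :=
  exists phi : forall (A : C) (B : D), hom (F A) B -> hom A (G B),
    (forall A B, bijective (phi A B)) /\
    (forall (A A' : C) (B B' : D) (a : hom A' A) (b : hom B B')
        (g : hom (F A) B),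
      phi A' B' (cmp b (cmp g (fhom F a))) =
      cmp (fhom G b) (cmp (phi A B g) a)).

Definition coreflector (C D : category) (E : functor C D) (G : functor D C) :=
  left_adjoint E G.
Definition reflector (C D : category) (E : functor C D) (L : functor D C) :=
  left_adjoint L E.

Definition full_coreflective (C D : category) (E : functor C D) :=
  [/\ full E, embedding E & exists G, coreflector E G].
Definition full_reflective (C D : category) (E : functor C D) :=
  [/\ full E, embedding E & exists L, reflector E L].

Record quantale := Quantale {
  qsort :> Type;
  qle : qsort -> qsort -> Prop;
  qle_refl : forall u, qle u u;
  qle_anti : forall u v, qle u v -> qle v u -> u = v;
  qle_trans : forall u v w, qle u v -> qle v w -> qle u w;
  qsup : set qsort -> qsort;
  qsup_ub : forall (S : set qsort) u, S u -> qle u (qsup S);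
  qsup_le : forall (S : set qsort) v,
    (forall u, S u -> qle u v) -> qle (qsup S) v;
  qmul : qsort -> qsort -> qsort;
  qunit : qsort;
  qmulA : forall u v w, qmul u (qmul v w) = qmul (qmul u v) w;
  qmul1m : forall u, qmul qunit u = u;
  qmulm1 : forall u, qmul u qunit = u;
  qmul_supl : forall (S : set qsort) v,
    qmul (qsup S) v = qsup [set qmul u v | u in S];
  qmul_supr : forall (S : set qsort) v,
    qmul v (qsup S) = qsup [set qmul v u | u in S] }.

Arguments qle {q} u v.
Arguments qsup {q} S.
Arguments qmul {q} u v.
Arguments qunit {q}.

Declare Scope quantale_scope.
Delimit Scope quantale_scope with Q.
Local Open Scope quantale_scope.
Notation "u ⊑ v" := (qle u v) (at level 70, no associativity) : quantale_scope.
Notation "u ⊗ v" := (qmul u v) (at level 40, left associativity)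
  : quantale_scope.

Definition qinf (V : quantale) (S : set V) : V :=
  qsup [set v | forall u, S u -> v ⊑ u].
Definition qbot (V : quantale) : V := qsup set0.
Definition qtop (V : quantale) : V := qsup setT.
Definition qjoin (V : quantale) (u v : V) : V := qsup [set u; v].

Definition integral (V : quantale) := qunit = qtop V.

(** The distributive law for arbitrary meets of arbitrary joins; [s] ranges
    over the choice functions of the family [AA]. *)
Definition completely_distributive (V : quantale) :=
  forall AA : set (set V),
    qinf [set qsup A | A in AA] =
    qsup [set qinf [set s A | A in AA]
         | s in [set s : set V -> V | forall A, AA A -> A (s A)]].

Definition monotone (V W : quantale) (theta : V -> W) :=
  forall u v, u ⊑ v -> theta u ⊑ theta v.

Definition galois (V W : quantale) (l : V -> W) (r : W -> V) :=
  forall v w, l v ⊑ w <-> v ⊑ r w.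

Section QuantaleTheory.
Variable V : quantale.
Implicit Types (u v w : V) (S : set V).

Lemma qinf_lb S u : S u -> qinf S ⊑ u.
Proof. by move=> Su; apply: qsup_le => v; apply. Qed.

Lemma qinf_ge S v : (forall u, S u -> v ⊑ u) -> v ⊑ qinf S.
Proof. by move=> h; apply: qsup_ub. Qed.

Lemma qbot_le v : qbot V ⊑ v.
Proof. exact: qsup_le. Qed.

Lemma qtop_ge v : v ⊑ qtop V.
Proof. exact: qsup_ub. Qed.

Lemma qjoinl u v : u ⊑ qjoin u v.
Proof. by apply: qsup_ub; left. Qed.

Lemma qjoinr u v : v ⊑ qjoin u v.
Proof. by apply: qsup_ub; right. Qed.

Lemma qjoin_le u v w : u ⊑ w -> v ⊑ w -> qjoin u v ⊑ w.
Proof. by move=> uw vw; apply: qsup_le => _ [] ->. Qed.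

Lemma qjoin_idr u v : u ⊑ v -> qjoin u v = v.
Proof.
move=> uv; apply: qle_anti; last exact: qjoinr.
by apply: qjoin_le => //; exact: qle_refl.
Qed.

Lemma qmul_le2r w u v : u ⊑ v -> u ⊗ w ⊑ v ⊗ w.
Proof.
move=> uv; rewrite -(qjoin_idr uv) [X in _ ⊑ X]qmul_supl.
by apply: qsup_ub; exists u => //; left.
Qed.

Lemma qmul_le2l w u v : u ⊑ v -> w ⊗ u ⊑ w ⊗ v.
Proof.
move=> uv; rewrite -(qjoin_idr uv) [X in _ ⊑ X]qmul_supr.
by apply: qsup_ub; exists u => //; left.
Qed.

Lemma qmul_le2 u u' v v' : u ⊑ u' -> v ⊑ v' -> u ⊗ v ⊑ u' ⊗ v'.
Proof.
by move=> uu vv; apply: (qle_trans (qmul_le2r v uu)); exact: qmul_le2l.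
Qed.

Lemma qmul_bot_l v : qbot V ⊗ v = qbot V.
Proof. by rewrite /qbot qmul_supl image_set0. Qed.

Lemma qmul_bot_r v : v ⊗ qbot V = qbot V.
Proof. by rewrite /qbot qmul_supr image_set0. Qed.

Definition totally_below u v :=
  forall S, v ⊑ qsup S -> exists2 s, S s & u ⊑ s.

Lemma cd_approx (cd : completely_distributive V) v :
  v ⊑ qsup [set u | totally_below u v].
Proof.
set AA := [set S | v ⊑ qsup S].
have le1 : v ⊑ qinf [set qsup A | A in AA].
  by apply: qinf_ge => _ [S vS <-].
apply: (qle_trans le1); rewrite cd; apply: qsup_le => _ [s sP <-].
apply: qsup_ub => S vS; exists (s S); first exact: sP.
by apply: qinf_lb; exists S.
Qed.

Lemma approx_cd : (forall v, v ⊑ qsup [set u | totally_below u v]) ->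
  completely_distributive V.
Proof.
move=> h AA; apply: qle_anti; last first.
  apply: qsup_le => _ [s sP <-]; apply: qinf_ge => _ [A AAA <-].
  have le1 : qinf [set s A | A in AA] ⊑ s A by apply: qinf_lb; exists A.
  by apply: (qle_trans le1); apply: qsup_ub; exact: sP.
apply: (qle_trans (h _)); apply: qsup_le => u ub.
have /choice [s sP] : forall A, exists w, AA A -> A w /\ u ⊑ w.
  move=> A; have [AAA|nA] := pselect (AA A); last by exists u.
  have [|w Aw uw] := ub A; last by exists w.
  by apply: qinf_lb; exists A.
have le1 : u ⊑ qinf [set s A | A in AA].
  by apply: qinf_ge => _ [A AAA <-]; case: (sP A AAA).
by apply: (qle_trans le1); apply: qsup_ub; exists s => // A /sP [].
Qed.

End QuantaleTheory.

Record ultra (X : Type) := Ultra {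
  uset :> set X -> Prop;
  uset_ultra : UltraFilter uset }.

#[global] Existing Instance uset_ultra.

Lemma ultraP (X : Type) (F G : ultra X) :
  (forall A, F A -> G A) -> F = G.
Proof.
case: F G => [F uF] [G uG] /= FG.
have E : G = F by apply: max_filter.
by rewrite E in uG *; congr Ultra; exact: Prop_irrelevance.
Qed.

Lemma ultraC (X : Type) (F : ultra X) A : ~ F A <-> F (~` A).
Proof.
split=> [nFA|FnA FA]; first by case: (in_ultra_setVsetC A (uset_ultra F)).
by have /filter_ex [x []] : F (A `&` ~` A) by exact: filterI.
Qed.

Lemma ultra_of (X : Type) (F : set_system X) :
  ProperFilter F -> (forall A, F A \/ F (~` A)) -> UltraFilter F.
Proof.
move=> PF FC; split=> // G PG FG; apply/seteqP; split=> // A GA.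
case: (FC A) => // /FG GnA.
by have /filter_ex [x []] : G (A `&` ~` A) by exact: filterI.
Qed.

Definition upoint (X : Type) (x : X) : ultra X :=
  Ultra (principal_filter_ultra x).

Lemma umap_ultra (X Y : Type) (f : X -> Y) (F : ultra X) :
  UltraFilter (fmap f (uset F)).
Proof.
apply: ultra_of => A; rewrite /fmap /=.
exact: (in_ultra_setVsetC (f @^-1` A) (uset_ultra F)).
Qed.

Definition umap (X Y : Type) (f : X -> Y) (F : ultra X) : ultra Y :=
  Ultra (umap_ultra f F).

Definition usum_set (X : Type) (XX : ultra (ultra X)) : set_system X :=
  [set A | XX [set F : ultra X | F A]].

Lemma usum_ultra (X : Type) (XX : ultra (ultra X)) :
  UltraFilter (usum_set XX).
Proof.
have ne A : usum_set XX A -> exists x, A x.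
  by rewrite /usum_set /= => /filter_ex [F /filter_ex].
have FF : Filter (usum_set XX).
  split.
  - by apply: (@filterE _ (uset XX)) => F; apply: filterT.
  - move=> A B hA hB; apply: (@filterS _ (uset XX)) (@filterI _ (uset XX) _ _ _ hA hB).
    by move=> F []; exact: filterI.
  - by move=> A B AB; apply: (@filterS _ (uset XX)) => F; exact: filterS.
apply: ultra_of; first exact: Build_ProperFilter_ex.
move=> A; have [|h] := in_ultra_setVsetC [set F : ultra X | F A] (uset_ultra XX).
  by left.
by right; apply: filterS h => F /= /ultraC.
Qed.

(** The Kowalski sum [Σ XX]. *)
Definition usum (X : Type) (XX : ultra (ultra X)) : ultra X :=
  Ultra (usum_ultra XX).

Section Structures.
Variable V : quantale.

Definition is_app (X : Type) (c : set X -> X -> V) :=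
  [/\ forall x, qunit ⊑ c [set x] x,
      forall (AA : set (set X)) (B : set X) (z : X),
        qinf [set qsup [set c A y | A in AA] | y in B] ⊗ c B z
          ⊑ c (\bigcup_(A in AA) A) z,
      forall x, c set0 x = qbot V &
      forall (A B : set X) x, c (A `|` B) x = qjoin (c A x) (c B x)].

Definition is_app_hom (X Y : Type) (c : set X -> X -> V)
    (d : set Y -> Y -> V) (f : X -> Y) :=
  forall A x, c A x ⊑ d (f @` A) (f x).

Record app := App {
  app_sort :> choiceType;
  app_c : set app_sort -> app_sort -> V;
  app_ax : is_app app_c }.

Definition is_alg (X : Type) (l : ultra X -> X -> V) :=
  (forall x, qunit ⊑ l (upoint x) x) /\
  (forall (XX : ultra (ultra X)) (F : ultra X) (z : X),
    qinf [set qsup [set l G y | G in AA & y in B] | AA in uset XX & B in uset F] ⊗ l F z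
      ⊑ l (usum XX) z).

Definition is_alg_hom (X Y : Type) (l : ultra X -> X -> V)
    (m : ultra Y -> Y -> V) (f : X -> Y) :=
  forall F x, l F x ⊑ m (umap f F) (f x).

Record alg := Alg {
  alg_sort :> choiceType;
  alg_l : ultra alg_sort -> alg_sort -> V;
  alg_ax : is_alg alg_l }.

Definition alg_of_app (X : Type) (c : set X -> X -> V) : ultra X -> X -> V :=
  fun F x => qinf [set c A x | A in uset F].

Definition app_of_alg (X : Type) (l : ultra X -> X -> V) : set X -> X -> V :=
  fun A x => qsup [set l F x | F in [set F : ultra X | F A]].

Lemma app_mono (X : Type) (c : set X -> X -> V) : is_app c ->
  forall A B x, A `<=` B -> c A x ⊑ c B x.
Proof.
by move=> [_ _ _ cU] A B x AB; rewrite -(setUidr AB) cU; exact: qjoinl.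
Qed.

Section Conversions.
Variables X Y : Type.
Implicit Types (c : set X -> X -> V) (l : ultra X -> X -> V).

Lemma alg_of_app_is_alg (cd : completely_distributive V) c :
  is_app c -> is_alg (alg_of_app c).
Proof.
move=> ac; have mono := app_mono ac; have [c1 cT _ _] := ac; split.
  move=> x; apply: qinf_ge => _ [A /principal_filterP Ax <-].
  by apply: (qle_trans (c1 x)); apply: mono => _ ->.
move=> XX F z; apply: qinf_ge => _ [A XXA <-].
set v := qinf _.
apply: (qle_trans (qmul_le2r _ (cd_approx cd v))).
rewrite qmul_supl; apply: qsup_le => _ [u uv <-].
pose B0 := [set y | u ⊑ c A y].
have FB0 : F B0.
  apply: contrapT => /ultraC FnB0.
  have [|_ [G GA [y nB0y <-]] ul] :=
      uv [set alg_of_app c G y | G in [set G : ultra X | G A] & y in ~` B0].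
    apply: qinf_lb; exists [set G : ultra X | G A] => //.
    by exists (~` B0).
  by apply: nB0y; apply: (qle_trans ul); apply: qinf_lb; exists A.
have le1 : u ⊑ qinf [set qsup [set c A' y | A' in [set A]] | y in B0].
  apply: qinf_ge => _ [y B0y <-]; apply: (qle_trans B0y).
  by apply: qsup_ub; exists A.
have le2 : alg_of_app c F z ⊑ c B0 z by apply: qinf_lb; exists B0.
apply: (qle_trans (qmul_le2 le1 le2)).
by apply: (qle_trans (cT _ _ _)); rewrite bigcup_set1; exact: qle_refl.
Qed.

Lemma app_of_alg_is_app (cd : completely_distributive V) l :
  is_alg l -> is_app (app_of_alg l).
Proof.
move=> [l1 lT]; split.
- move=> x; apply: (qle_trans (l1 x)); apply: qsup_ub; exists (upoint x) => //.
- move=> AA B z; rewrite [X in _ ⊗ X]/app_of_alg qmul_supr.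
  apply: qsup_le => _ [_ [F FB <-] <-].
  set v := qinf _; apply: (qle_trans (qmul_le2r _ (cd_approx cd v))).
  rewrite qmul_supl; apply: qsup_le => _ [u uv <-].
  have /choice [g gP] : forall y, exists G : ultra X,
      B y -> G (\bigcup_(A in AA) A) /\ u ⊑ l G y.
    move=> y; have [By|nBy] := pselect (B y); last by exists F.
    have [|w [A AAA] [G GA] <- ul] :=
        uv [set w | exists2 A, AA A & exists2 G : ultra X, G A & l G y = w].
      have le1 : v ⊑ qsup [set app_of_alg l A y | A in AA].
        by apply: qinf_lb; exists y.
      apply: (qle_trans le1); apply: qsup_le => _ [A AAA <-].
      by apply: qsup_le => _ [G GA <-]; apply: qsup_ub; exists A => //; exists G.
    exists G => _; split=> //; apply: filterS GA => x Ax.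
    by exists A.
  have le1 : u ⊑ qinf [set qsup [set l G y | G in CC & y in D]
                      | CC in uset (umap g F) & D in uset F].
    apply: qinf_ge => _ [CC gCC [D FD <-]].
    have /filter_ex [y [[gy Dy] By]] : F (g @^-1` CC `&` D `&` B).
      by do 2?apply: filterI.
    have [_ ul] := gP y By; apply: (qle_trans ul); apply: qsup_ub.
    by exists (g y) => //; exists y.
  apply: (qle_trans (qmul_le2r _ le1)); apply: (qle_trans (lT _ _ _)).
  apply: qsup_ub; exists (usum (umap g F)) => //=.
  by apply: filterS FB => y /gP [].
- move=> x; apply: qle_anti (qbot_le _); apply: qsup_le => _ [F F0 <-].
  by have /filter_ex [] := F0.
- move=> A B x; apply: qle_anti.
    apply: qsup_le => _ [F FAB <-].
    have [FA|/ultraC FnA] := pselect (F A).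
      by apply: (qle_trans _ (qjoinl _ _)); apply: qsup_ub; exists F.
    apply: (qle_trans _ (qjoinr _ _)); apply: qsup_ub; exists F => //=.
    by apply: filterS (filterI FAB FnA) => y [[]].
  apply: qjoin_le; apply: qsup_le => _ [F FA <-]; apply: qsup_ub;
    exists F => //; apply: filterS FA => y; by [left|right].
Qed.

Lemma alg_of_app_hom c (d : set Y -> Y -> V) (f : X -> Y) :
  is_app d -> is_app_hom c d f -> is_alg_hom (alg_of_app c) (alg_of_app d) f.
Proof.
move=> ad fh F x; apply: qinf_ge => _ [B FB <-].
have le1 : alg_of_app c F x ⊑ c (f @^-1` B) x by apply: qinf_lb; exists (f @^-1` B).
apply: (qle_trans le1); apply: (qle_trans (fh _ _)); apply: (app_mono ad).
exact: image_preimage_subset.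
Qed.

Lemma app_of_alg_hom l (m : ultra Y -> Y -> V) (f : X -> Y) :
  is_alg_hom l m f -> is_app_hom (app_of_alg l) (app_of_alg m) f.
Proof.
move=> fh A x; apply: qsup_le => _ [F FA <-]; apply: (qle_trans (fh _ _)).
apply: qsup_ub; exists (umap f F) => //=.
by apply: filterS FA => y Ay; exists y.
Qed.

End Conversions.

Lemma umap_id (X : Type) (F : ultra X) : umap id F = F.
Proof. exact: ultraP. Qed.

Lemma umap_comp (X Y Z : Type) (g : Y -> Z) (f : X -> Y) (F : ultra X) :
  umap (g \o f) F = umap g (umap f F).
Proof. exact: ultraP. Qed.

Lemma umap_upoint (X Y : Type) (f : X -> Y) x : umap f (upoint x) = upoint (f x).
Proof. by apply: ultraP => A /principal_filterP ?; exact/principal_filterP. Qed.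

Lemma umap_usum (X Y : Type) (f : X -> Y) XX :
  umap f (usum XX) = usum (umap (umap f) XX).
Proof. exact: ultraP. Qed.

Program Definition VApp : category :=
  {| obj := app;
     hom := fun X Y => {f : X -> Y | is_app_hom (@app_c X) (@app_c Y) f};
     idm := fun X => exist _ id _;
     cmp := fun X Y Z g f => exist _ (sval g \o sval f) _ |}.
Next Obligation. by move=> X A x; rewrite image_id; exact: qle_refl. Qed.
Next Obligation.
move=> X Y Z [g gP] [f fP] A x /=; apply: (qle_trans (fP _ _)).
by apply: (qle_trans (gP _ _)); rewrite image_comp; exact: qle_refl.
Qed.
Next Obligation. by move=> X Y [f fP]; exact: eq_exist. Qed.
Next Obligation. by move=> X Y [f fP]; exact: eq_exist. Qed.
Next Obligation. by move=> X Y Z T [h hP] [g gP] [f fP]; exact: eq_exist. Qed.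

Program Definition BAlg : category :=
  {| obj := alg;
     hom := fun X Y => {f : X -> Y | is_alg_hom (@alg_l X) (@alg_l Y) f};
     idm := fun X => exist _ id _;
     cmp := fun X Y Z g f => exist _ (sval g \o sval f) _ |}.
Next Obligation. by move=> X F x; rewrite umap_id; exact: qle_refl. Qed.
Next Obligation.
move=> X Y Z [g gP] [f fP] F x /=; apply: (qle_trans (fP _ _)).
by rewrite umap_comp; exact: gP.
Qed.
Next Obligation. by move=> X Y [f fP]; exact: eq_exist. Qed.
Next Obligation. by move=> X Y [f fP]; exact: eq_exist. Qed.
Next Obligation. by move=> X Y Z T [h hP] [g gP] [f fP]; exact: eq_exist. Qed.

(** The mutually inverse functors that identify [VApp] with [BAlg]. *)

Program Definition AlgOfApp (cd : completely_distributive V) :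
    functor VApp BAlg :=
  {| fobj := fun X : VApp => Alg (alg_of_app_is_alg cd (@app_ax X)) : BAlg;
     fhom := fun X Y f => exist _ (sval f) _ |}.
Next Obligation.
by move=> cd X Y [f fP]; apply: alg_of_app_hom fP; exact: app_ax.
Qed.
Next Obligation. by move=> *; exact: eq_exist. Qed.
Next Obligation. by move=> *; exact: eq_exist. Qed.

Program Definition AppOfAlg (cd : completely_distributive V) :
    functor BAlg VApp :=
  {| fobj := fun X : BAlg => App (app_of_alg_is_app cd (@alg_ax X)) : VApp;
     fhom := fun X Y f => exist _ (sval f) _ |}.
Next Obligation. by move=> cd X Y [f fP]; exact: app_of_alg_hom fP. Qed.
Next Obligation. by move=> *; exact: eq_exist. Qed.
Next Obligation. by move=> *; exact: eq_exist. Qed.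

End Structures.

Section ChangeOfBase.
Variables (V W : quantale) (theta : V -> W).

Definition alg_along (X : Type) (l : ultra X -> X -> V) : ultra X -> X -> W :=
  fun F x => theta (l F x).

Definition alg_preserving :=
  forall (X : Type) (l : ultra X -> X -> V), is_alg l -> is_alg (alg_along l).

(** The pointwise infimum of all ([β], [W])-algebra structures above
    [theta \o l]; it is itself such a structure, hence the least one. *)
Definition alg_bar (X : Type) (l : ultra X -> X -> V) : ultra X -> X -> W :=
  fun F x => qinf [set m F x | m in [set m : ultra X -> X -> W |
    is_alg m /\ forall G y, alg_along l G y ⊑ m G y]].

Lemma alg_bar_is_alg (X : Type) (l : ultra X -> X -> V) : is_alg (alg_bar l).
Proof.
split.
  by move=> x; apply: qinf_ge => _ [m [[m1 _] _] <-]; exact: m1.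
move=> XX F z; apply: qinf_ge => _ [m [[m1 mT] lm] <-].
have le G y : alg_bar l G y ⊑ m G y by apply: qinf_lb; exists m.
apply: (qle_trans _ (mT XX F z)); apply: qmul_le2; last exact: le.
apply: qinf_ge => _ [AA XA [B FB <-]].
have le1 : qinf [set qsup [set alg_bar l G y | G in AA & y in B]
                | AA in uset XX & B in uset F]
    ⊑ qsup [set alg_bar l G y | G in AA & y in B].
  by apply: qinf_lb; exists AA => //; exists B.
apply: (qle_trans le1); apply: qsup_le => _ [G AG [y By <-]].
by apply: (qle_trans (le G y)); apply: qsup_ub; exists G => //; exists y.
Qed.

Lemma alg_bar_ge (X : Type) (l : ultra X -> X -> V) F x :
  theta (l F x) ⊑ alg_bar l F x.
Proof. by apply: qinf_ge => _ [m [_ lm] <-]; exact: lm. Qed.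

Lemma alg_bar_least (X : Type) (l : ultra X -> X -> V) (m : ultra X -> X -> W) :
  is_alg m -> (forall F x, theta (l F x) ⊑ m F x) ->
  forall F x, alg_bar l F x ⊑ m F x.
Proof. by move=> am lm F x; apply: qinf_lb; exists m. Qed.

Lemma alg_pullback (X Y : Type) (f : X -> Y) (m : ultra Y -> Y -> W) :
  is_alg m -> is_alg (fun F x => m (umap f F) (f x)).
Proof.
move=> [m1 mT]; split=> [x|XX F z]; first by rewrite umap_upoint; exact: m1.
rewrite umap_usum; apply: (qle_trans _ (mT _ _ _)); apply: qmul_le2r.
apply: qinf_ge => _ [AA XA [B FB <-]].
set S := [set m (umap f G) (f y) | G in (umap f) @^-1` AA & y in f @^-1` B].
have le1 : qinf [set qsup [set m (umap f G) (f y) | G in AA & y in B]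
                | AA in uset XX & B in uset F] ⊑ qsup S.
  by apply: qinf_lb; exists (umap f @^-1` AA) => //; exists (f @^-1` B).
apply: (qle_trans le1); apply: qsup_le => _ [G AG [y By <-]].
by apply: qsup_ub; exists (umap f G) => //; exists (f y).
Qed.

Hypothesis mono : monotone theta.

Program Definition Bfun (pres : alg_preserving) : functor (BAlg V) (BAlg W) :=
  {| fobj := fun X : BAlg V => Alg (pres _ _ (@alg_ax V X)) : BAlg W;
     fhom := fun X Y f => exist _ (sval f) _ |}.
Next Obligation. by move=> pres X Y [f fP] F x; apply: mono; exact: fP. Qed.
Next Obligation. by move=> *; exact: eq_exist. Qed.
Next Obligation. by move=> *; exact: eq_exist. Qed.

Program Definition Bbarfun : functor (BAlg V) (BAlg W) :=
  {| fobj := fun X : BAlg V => Alg (alg_bar_is_alg (@alg_l V X)) : BAlg W;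
     fhom := fun X Y f => exist _ (sval f) _ |}.
Next Obligation.
move=> X Y [f fP]; apply: alg_bar_least.
  by apply: alg_pullback; exact: alg_bar_is_alg.
move=> F x; apply: (qle_trans _ (alg_bar_ge _ _ _)); apply: mono; exact: fP.
Qed.
Next Obligation. by move=> *; exact: eq_exist. Qed.
Next Obligation. by move=> *; exact: eq_exist. Qed.

End ChangeOfBase.

Program Definition two : quantale :=
  {| qsort := bool;
     qle := fun a b => a -> b;
     qsup := fun S => `[< S true >];
     qmul := andb;
     qunit := true |}.
Next Obligation. by []. Qed.
Next Obligation. by case=> [] [] //= h1 h2; [have := h1 isT|have := h2 isT]. Qed.
Next Obligation. by move=> a b c ab bc /ab /bc. Qed.
Next Obligation. by move=> S [] // St _; exact/asboolP. Qed.
Next Obligation. by move=> S v h /asboolP /h; apply. Qed.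
Next Obligation. exact: andbA. Qed.
Next Obligation. by []. Qed.
Next Obligation. exact: andbT. Qed.
Next Obligation.
move=> S v; apply/idP/idP.
  by move=> /andP[/asboolP St vt]; apply/asboolP; exists true.
by move=> /asboolP [[] // St /= ->]; rewrite andbT; exact/asboolP.
Qed.
Next Obligation.
move=> S v; apply/idP/idP.
  by move=> /andP[vt /asboolP St]; apply/asboolP; exists true; rewrite ?vt.
by move=> /asboolP [[] St]; rewrite ?andbF // andbT => -> /=; exact/asboolP.
Qed.

Lemma two_infP (S : set two) : (qinf S : bool) <-> forall b : bool, S b -> b.
Proof.
split=> [h b Sb|h]; first by have := @qinf_lb two S b Sb; apply.
by apply/asboolP => b Sb _; exact: h.
Qed.

Definition alg_of_top (T : topologicalType) : ultra T -> T -> two :=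
  fun F x => `[< (uset F : set_system T) --> x >].

Lemma alg_of_topP (T : topologicalType) (F : ultra T) x :
  alg_of_top F x <-> forall U, open U -> U x -> F U.
Proof.
split=> [/asboolP Fx U oU Ux|h]; first by apply: Fx; exact: open_nbhs_nbhs.
apply/asboolP => A; rewrite nbhsE => -[U [oU Ux] UA].
by apply: (@filterS _ (uset F)) UA _; exact: h.
Qed.

Lemma alg_of_top_is_alg (T : topologicalType) : is_alg (@alg_of_top T).
Proof.
split=> [x _|XX F z].
  by apply/alg_of_topP => U _ Ux; exact/principal_filterP.
move=> /andP[/two_infP h /alg_of_topP Fz]; apply/alg_of_topP => U oU Uz.
apply: contrapT => /ultraC nU.
have FU := Fz U oU Uz.
pose AA := [set G : ultra T | G (~` U)].
have : (qsup [set alg_of_top G y | G in AA & y in U] : bool).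
  by apply: h; exists AA => //; exists U.
move=> /asboolP [G /ultraC nGU [y Uy /alg_of_topP Gy]].
by apply: nGU; exact: Gy.
Qed.

Lemma continuous_alg_hom (S T : topologicalType) (f : S -> T) :
  continuous f -> is_alg_hom (@alg_of_top S) (@alg_of_top T) f.
Proof.
move=> /continuousP cf F x /alg_of_topP Fx; apply/alg_of_topP => U oU Ux.
by apply: Fx => //; exact: cf.
Qed.

(** [U] is open if it belongs to every ultrafilter converging to a point
    of [U]. *)
Definition alg_open (X : Type) (l : ultra X -> X -> two) : set_system X :=
  [set U | forall F x, l F x -> U x -> F U].

Section TopOfAlg.
Variable X : alg two.

Lemma alg_openT : alg_open (@alg_l two X) setT.
Proof. by move=> F x _ _; exact: filterT. Qed.

Lemma alg_openI : setI_closed (alg_open (@alg_l two X)).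
Proof.
move=> A B oA oB F x Fx [Ax Bx].
by apply: filterI; [exact: oA Fx Ax|exact: oB Fx Bx].
Qed.

Lemma alg_open_bigU (I : Type) (f : I -> set X) :
  (forall i, alg_open (@alg_l two X) (f i)) ->
  alg_open (@alg_l two X) (\bigcup_i f i).
Proof.
move=> of_ F x Fx [i _ fix_].
by apply: filterS (of_ i F x Fx fix_) => y ?; exists i.
Qed.

Definition top_of_alg : Type := X.
HB.instance Definition _ := Choice.on top_of_alg.
HB.instance Definition _ :=
  isOpenTopological.Build top_of_alg alg_openT alg_openI alg_open_bigU.

End TopOfAlg.

Lemma alg_hom_continuous (X Y : alg two) (f : X -> Y) :
  is_alg_hom (@alg_l two X) (@alg_l two Y) f ->
  continuous (f : top_of_alg X -> top_of_alg Y).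
Proof.
move=> fh; apply/continuousP => A oA.
have {}oA : alg_open (@alg_l two Y) A by exact: oA.
suff : alg_open (@alg_l two X) (f @^-1` A) by [].
by move=> F x Fx Afx; exact: oA (fh F x Fx) Afx.
Qed.

Program Definition Top : category :=
  {| obj := topologicalType;
     hom := fun S T => {f : S -> T | continuous f};
     idm := fun T => exist _ id _;
     cmp := fun S T U g f => exist _ (sval g \o sval f) _ |}.
Next Obligation. by move=> T x. Qed.
Next Obligation.
move=> S T U [g gP] [f fP] x /=; apply: continuous_comp; [exact: fP|exact: gP].
Qed.
Next Obligation. by move=> X Y [f fP]; exact: eq_exist. Qed.
Next Obligation. by move=> X Y [f fP]; exact: eq_exist. Qed.
Next Obligation. by move=> X Y Z T [h hP] [g gP] [f fP]; exact: eq_exist. Qed.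

(** The mutually inverse functors that identify [Top] with [BAlg two]. *)

Program Definition AlgOfTop : functor Top (BAlg two) :=
  {| fobj := fun T : Top => Alg (@alg_of_top_is_alg T) : BAlg two;
     fhom := fun S T f => exist _ (sval f) _ |}.
Next Obligation. by move=> S T [f fP]; exact: continuous_alg_hom. Qed.
Next Obligation. by move=> *; exact: eq_exist. Qed.
Next Obligation. by move=> *; exact: eq_exist. Qed.

Program Definition TopOfAlg : functor (BAlg two) Top :=
  {| fobj := fun X : BAlg two => top_of_alg X : Top;
     fhom := fun X Y f => exist _ (sval f) _ |}.
Next Obligation. by move=> S T [f fP]; exact: alg_hom_continuous. Qed.
Next Obligation. by move=> *; exact: eq_exist. Qed.
Next Obligation. by move=> *; exact: eq_exist. Qed.

Section TopAndVApp.
Variable V : quantale.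

Definition iota_map : two -> V := fun b => if b then qunit else qbot V.
Definition pi_map : V -> two := fun v => `[< qunit ⊑ v >].
Definition o_map : V -> two := fun v => `[< v <> qbot V >].

Lemma iota_mono : monotone iota_map.
Proof.
move=> [] [] //= h; rewrite /iota_map; try exact: qbot_le; try exact: qle_refl.
by have := h isT.
Qed.

Lemma pi_mono : monotone pi_map.
Proof. by move=> u v uv /asboolP h; apply/asboolP; exact: qle_trans uv. Qed.

Lemma o_mono : monotone o_map.
Proof.
move=> u v uv /asboolP u0; apply/asboolP => v0; apply: u0.
by apply: qle_anti (qbot_le _); rewrite -v0 //.
Qed.

Lemma iota_pres : alg_preserving iota_map.
Proof.
move=> X l [l1 lT]; split=> [x|XX F z].
  by have := l1 x; rewrite /alg_along; case: (l _ _) => [_|/(_ isT)//]; exact: qle_refl.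
rewrite {2 3}/alg_along; case lF : (l F z); last first.
  by rewrite qmul_bot_r; exact: qbot_le.
rewrite {2}/iota_map qmulm1.
set b := qinf [set qsup [set l G y | G in AA & y in B] | AA in uset XX & B in uset F].
case bE : (b : bool).
  have := lT XX F z; rewrite -/b bE lF => /(_ isT) -> /=.
  apply: (qle_trans (qinf_lb (u := qsup [set alg_along iota_map l G y | G in setT & y in setT]) _)).
    by exists setT; [exact: filterT|exists setT; [exact: filterT|]].
  apply: qsup_le => _ [G _ [y _ <-]]; rewrite /alg_along.
  by case: (l G y); [exact: qle_refl|exact: qbot_le].
have [AA XA [B FB nG]] : exists2 AA, XX AA & exists2 B, F B &
    forall G y, AA G -> B y -> l G y = false.
  apply: contrapT => h; move: bE; suff bT : (b : bool) by rewrite bT.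
  apply/two_infP => _ [AA XA [B FB <-]]; apply/asboolP.
  apply: contrapT => nl; apply: h; exists AA => //; exists B => // G y AG By.
  by apply/negP => lGy; apply: nl; exists G => //; exists y.
apply: (qle_trans (qinf_lb (u := qsup [set alg_along iota_map l G y | G in AA & y in B]) _)).
  by exists AA => //; exists B.
apply: qsup_le => _ [G AG [y By <-]]; rewrite /alg_along nG //.
exact: qbot_le.
Qed.

Lemma pi_pres : alg_preserving pi_map.
Proof.
move=> X l [l1 lT]; split=> [x _|XX F z]; first by apply/asboolP; exact: l1.
move=> /andP[/two_infP h /asboolP lF]; apply/asboolP.
apply: (qle_trans _ (lT XX F z)); rewrite -{1}(qmulm1 (@qunit V)).
apply: qmul_le2 => //; apply: qinf_ge => _ [AA XA [B FB <-]].
have : (qsup [set alg_along pi_map l G y | G in AA & y in B] : bool).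
  by apply: h; exists AA => //; exists B.
move=> /asboolP [G AG [y By /asboolP lG]].
by apply: (qle_trans lG); apply: qsup_ub; exists G => //; exists y.
Qed.

Variable cd : completely_distributive V.

Definition B_iota : functor Top (VApp V) :=
  fcomp (AppOfAlg cd) (fcomp (Bfun iota_mono iota_pres) AlgOfTop).
Definition B_pi : functor (VApp V) Top :=
  fcomp TopOfAlg (fcomp (Bfun pi_mono pi_pres) (AlgOfApp cd)).
Definition Bbar_o : functor (VApp V) Top :=
  fcomp TopOfAlg (fcomp (Bbarfun o_mono) (AlgOfApp cd)).

End TopAndVApp.

Section ExtendedHalfLine.
Variable R : realType.
Local Open Scope ereal_scope.

Definition ext0 := {x : \bar R | 0 <= x}.

Definition ext0_mk (x : \bar R) (x0 : 0 <= x) : ext0 := exist _ x x0.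

Definition ext0_inf_val (S : set ext0) : \bar R := ereal_inf [set sval x | x in S].

Lemma ext0_inf_ge0 (S : set ext0) : 0 <= ext0_inf_val S.
Proof. by apply: le_ereal_inf_tmp => _ [x _ <-]; exact: (svalP x). Qed.

Definition ext0_inf (S : set ext0) : ext0 := ext0_mk (ext0_inf_ge0 S).

Lemma ext0_add_ge0 (x y : ext0) : 0 <= sval x + sval y.
Proof. by apply: adde_ge0; [exact: (svalP x)|exact: (svalP y)]. Qed.

Definition ext0_add (x y : ext0) : ext0 := ext0_mk (ext0_add_ge0 x y).
Definition ext0_0 : ext0 := ext0_mk (lexx 0).

Lemma ext0_eq (x y : ext0) : sval x = sval y -> x = y.
Proof. by move=> h; apply: val_inj. Qed.

Lemma ext0_addC x y : ext0_add x y = ext0_add y x.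
Proof. by apply: ext0_eq; rewrite /= addeC. Qed.

Lemma ext0_inf_add (S : set ext0) v :
  ext0_add (ext0_inf S) v = ext0_inf [set ext0_add u v | u in S].
Proof.
apply: ext0_eq => /=; apply/le_anti/andP; split.
  apply: le_ereal_inf_tmp => _ [_ [u Su <-] <-] /=; apply: leeD => //.
  by apply: ereal_inf_lbound; exists u.
have [vf|] := boolP (sval v \is a fin_num); last first.
  rewrite ge0_fin_numE ?(svalP v)// -leNgt leye_eq => /eqP ->.
  by rewrite addey ?leey// -ltNye (lt_le_trans _ (ext0_inf_ge0 S)) ?ltNyr.
rewrite -leeBlDr//; apply: le_ereal_inf_tmp => _ [u Su <-].
by rewrite leeBlDr//; apply: ereal_inf_lbound; exists (ext0_add u v) => //; exists u.
Qed.

(** The lattice order is the reverse of the natural one: suprema in the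
    quantale are infima of extended reals. *)
Program Definition Pplus : quantale :=
  {| qsort := ext0;
     qle := fun x y => sval y <= sval x;
     qsup := ext0_inf;
     qmul := ext0_add;
     qunit := ext0_0 |}.
Next Obligation. by []. Qed.
Next Obligation. by move=> u v uv vu; apply: ext0_eq; apply/le_anti/andP. Qed.
Next Obligation. by move=> u v w uv vw; exact: le_trans uv. Qed.
Next Obligation. by move=> S u Su; apply: ereal_inf_lbound; exists u. Qed.
Next Obligation.
by move=> S v h; apply: le_ereal_inf_tmp => _ [u Su <-]; exact: h.
Qed.
Next Obligation. by move=> u v w; apply: ext0_eq; rewrite /= addeA. Qed.
Next Obligation. by move=> u; apply: ext0_eq; rewrite /= add0e. Qed.
Next Obligation. by move=> u; apply: ext0_eq; rewrite /= adde0. Qed.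
Next Obligation. exact: ext0_inf_add. Qed.
Next Obligation.
move=> S v; rewrite ext0_addC ext0_inf_add; congr ext0_inf.
by apply: eq_imagel => u _; exact: ext0_addC.
Qed.

Lemma Pplus_cd : completely_distributive Pplus.
Proof.
apply: approx_cd => v /=.
have below (u : ext0) : sval v < sval u -> @totally_below Pplus u v.
  move=> vu S /= vS; have [|_ [s Ss <-] su] := @ereal_inf_lt _ [set sval x | x in S] (sval u).
    exact: le_lt_trans vu.
  by exists s => //=; exact: ltW.
have [vf|] := boolP (sval v \is a fin_num); last first.
  by rewrite ge0_fin_numE ?(svalP v)// -leNgt leye_eq => /eqP ->; exact: leey.
apply/lee_addgt0Pr => e e0.
have ve0 : 0 <= sval v + e%:E by rewrite adde_ge0 ?(svalP v)// lee_fin ltW.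
apply: ereal_inf_lbound; exists (ext0_mk ve0) => //; apply: below.
by rewrite /= lteDl// lte_fin.
Qed.

Lemma ext0_dense (x y : ext0) : sval x < sval y ->
  exists2 z : ext0, sval x < sval z & sval z < sval y.
Proof.
case: x y => [x x0] [y y0] /=; case: x x0 => [r| |] //= r0.
  case: y y0 => [s| |] //= s0 rs.
    have h : 0 <= ((r + s) / 2)%:E by rewrite lee_fin divr_ge0 ?addr_ge0// -lee_fin.
    by rewrite lte_fin in rs; exists (ext0_mk h); rewrite /= lte_fin; have [] := midf_lt rs.
  have h : 0 <= (r + 1)%:E by rewrite lee_fin addr_ge0// -lee_fin.
  by exists (ext0_mk h); rewrite /= ?ltry// lte_fin ltrDl.
by rewrite ltNge leey.
Qed.

End ExtendedHalfLine.

Section Distributions.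
Variable R : realType.
Local Open Scope ring_scope.
Local Notation E := (ext0 R).

(** The supremum defining the value at 0 is over the empty set, where
    [sup] is 0, the bottom element of [0, 1]. *)
Record ddf := Ddf {
  ddf_fun :> E -> R;
  ddf_01 : forall a, 0 <= ddf_fun a <= 1;
  ddf_left : forall b,
    ddf_fun b = sup [set ddf_fun a | a in [set a : E | (sval a < sval b)%E]] }.

Lemma ddf_eq (f g : ddf) : (forall a, f a = g a) -> f = g.
Proof.
case: f g => [f f1 f2] [g g1 g2] /= fg.
have E : f = g by exact: funext.
by subst g; congr Ddf; exact: Prop_irrelevance.
Qed.

Lemma ddf_ge0 (f : ddf) a : 0 <= f a. Proof. by case/andP: (ddf_01 f a). Qed.
Lemma ddf_le1 (f : ddf) a : f a <= 1. Proof. by case/andP: (ddf_01 f a). Qed.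

Lemma sup1_ub (S : set R) x : (forall y, S y -> y <= 1) -> S x -> x <= sup S.
Proof. by move=> S1; apply: ub_le_sup; exists 1. Qed.

Lemma sup_le0 (S : set R) b : 0 <= b -> (forall y, S y -> y <= b) -> sup S <= b.
Proof.
move=> b0 Sb; have [->|/set0P S0] := eqVneq S set0; first by rewrite sup0.
exact: ge_sup.
Qed.

Lemma sup1_ge0 (S : set R) : (forall y, S y -> 0 <= y <= 1) -> 0 <= sup S.
Proof.
move=> S01; have [->|/set0P [x Sx]] := eqVneq S set0; first by rewrite sup0.
have /andP[x0 _] := S01 x Sx; apply: (le_trans x0); apply: sup1_ub => //.
by move=> y /S01 /andP[].
Qed.

Lemma mul_sup_le (S : set R) (x b : R) : 0 <= x -> 0 <= b ->
  (forall y, S y -> x * y <= b) -> x * sup S <= b.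
Proof.
rewrite le_eqVlt => /orP[/eqP <-|x0] b0 h; first by rewrite mul0r.
rewrite mulrC -ler_pdivlMr//; apply: sup_le0; first by rewrite divr_ge0// ltW.
by move=> y Sy; rewrite ler_pdivlMr// mulrC; exact: h.
Qed.

Lemma ddf_mono (f : ddf) a b : (sval a <= sval b)%E -> f a <= f b.
Proof.
move=> ab; rewrite (ddf_left f a); apply: sup_le0; first exact: ddf_ge0.
move=> _ [c /= ca <-]; rewrite (ddf_left f b).
apply: sup1_ub; first by move=> _ [d _ <-]; exact: ddf_le1.
by exists c => //=; exact: lt_le_trans ab.
Qed.

Lemma mk_left (f : E -> R) : (forall a, 0 <= f a <= 1) ->
  (forall a b, (sval a <= sval b)%E -> f a <= f b) ->
  (forall b r, 0 <= r -> (forall a, (sval a < sval b)%E -> f a <= r) -> f b <= r) ->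
  forall b, f b = sup [set f a | a in [set a : E | (sval a < sval b)%E]].
Proof.
move=> f01 fm fl b; apply/le_anti/andP; split; last first.
  apply: sup_le0; first by case/andP: (f01 b).
  by move=> _ [a /= ab <-]; apply: fm; exact: ltW.
apply: fl => [|a ab]; first by apply: sup1_ge0 => _ [a _ <-].
apply: sup1_ub; last by exists a.
by move=> _ [c _ <-]; case/andP: (f01 c).
Qed.

Definition ddf_sup_fun (S : set ddf) : E -> R := fun a => sup [set f a | f in S].

Lemma ddf_sup_ub S (f : ddf) a : S f -> f a <= ddf_sup_fun S a.
Proof.
move=> Sf; apply: sup1_ub; last by exists f.
by move=> _ [g _ <-]; exact: ddf_le1.
Qed.

Lemma ddf_sup_01 S a : 0 <= ddf_sup_fun S a <= 1.
Proof.
apply/andP; split; first by apply: sup1_ge0 => _ [f _ <-]; exact: ddf_01.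
by apply: sup_le0 => // _ [f _ <-]; exact: ddf_le1.
Qed.

Lemma ddf_sup_left S b : ddf_sup_fun S b =
  sup [set ddf_sup_fun S a | a in [set a : E | (sval a < sval b)%E]].
Proof.
apply: mk_left; first exact: ddf_sup_01.
  move=> x y xy; apply: sup_le0; first by case/andP: (ddf_sup_01 S y).
  move=> _ [f Sf <-]; apply: le_trans (ddf_sup_ub _ Sf); exact: ddf_mono.
move=> y r r0 h; apply: sup_le0 => // _ [f Sf <-]; rewrite ddf_left.
apply: sup_le0 => // _ [a /= ay <-]; apply: le_trans (h a ay).
exact: ddf_sup_ub.
Qed.

Definition ddf_sup S : ddf := Ddf (ddf_sup_01 S) (ddf_sup_left S).

Definition ddf_mul_fun (f g : E -> R) : E -> R := fun c =>
  sup [set f p.1 * g p.2 | p in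
    [set p : E * E | (sval p.1 + sval p.2 <= sval c)%E]].

Lemma ddf_mul_ub (f g : ddf) a b c : (sval a + sval b <= sval c)%E ->
  f a * g b <= ddf_mul_fun f g c.
Proof.
move=> abc; apply: sup1_ub; last by exists (a, b).
by move=> _ [p _ <-]; apply: mulr_ile1; rewrite ?ddf_ge0 ?ddf_le1.
Qed.

Lemma ddf_mul_le (f g : ddf) c r : 0 <= r ->
  (forall a b, (sval a + sval b <= sval c)%E -> f a * g b <= r) ->
  ddf_mul_fun f g c <= r.
Proof. by move=> r0 h; apply: sup_le0 => // _ [[a b] /= abc <-]; exact: h. Qed.

Lemma ddf_mul_01 (f g : ddf) c : 0 <= ddf_mul_fun f g c <= 1.
Proof.
apply/andP; split.
  apply: sup1_ge0 => _ [p _ <-].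
  by rewrite mulr_ge0 ?ddf_ge0//= mulr_ile1 ?ddf_ge0 ?ddf_le1.
by apply: ddf_mul_le => // a b _; apply: mulr_ile1; rewrite ?ddf_ge0 ?ddf_le1.
Qed.

Lemma ddf_mul_left (f g : ddf) c : ddf_mul_fun f g c =
  sup [set ddf_mul_fun f g a | a in [set a : E | (sval a < sval c)%E]].
Proof.
apply: mk_left; first exact: ddf_mul_01.
  move=> x y xy; apply: ddf_mul_le; first by case/andP: (ddf_mul_01 f g y).
  by move=> a b abx; apply: ddf_mul_ub; exact: le_trans xy.
move=> y r r0 h; apply: ddf_mul_le => // a b aby.
rewrite (ddf_left g b); apply: mul_sup_le => //; first exact: ddf_ge0.
move=> _ [b' /= bb <-]; rewrite mulrC (ddf_left f a).
apply: mul_sup_le => //; first exact: ddf_ge0.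
move=> _ [a' /= aa <-]; rewrite mulrC.
have lt1 : (sval (ext0_add a' b') < sval y)%E.
  by apply: lt_le_trans aby => /=; exact: lteD.
by apply: le_trans (h _ lt1); exact: ddf_mul_ub.
Qed.

Definition ddf_mul (f g : ddf) : ddf := Ddf (ddf_mul_01 f g) (ddf_mul_left f g).

Definition ddf_unit_fun : E -> R := fun a => if sval a == 0%E then 0 else 1.

Lemma ddf_unit_01 a : 0 <= ddf_unit_fun a <= 1.
Proof. by rewrite /ddf_unit_fun; case: ifP => _; rewrite ?lexx ?ler01. Qed.

Lemma ext0_eq0 (a : E) : (sval a == 0%E) = ~~ (0 < sval a)%E.
Proof. by rewrite -leNgt eq_le (svalP a) andbT. Qed.

Lemma ddf_unit_left b : ddf_unit_fun b =
  sup [set ddf_unit_fun a | a in [set a : E | (sval a < sval b)%E]].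
Proof.
apply: mk_left; first exact: ddf_unit_01.
  move=> x y xy; rewrite /ddf_unit_fun !ext0_eq0.
  case: ifPn => [_|/negPn x0]; first by case: ifP => _; rewrite ?lexx ?ler01.
  by rewrite (lt_le_trans x0 xy).
move=> y r r0 h; rewrite /ddf_unit_fun ext0_eq0; case: ifPn => // /negPn y0.
have [z z0 zy] := @ext0_dense R (ext0_0 R) y y0.
by apply: le_trans (h z zy); rewrite /ddf_unit_fun ext0_eq0 z0.
Qed.

Definition ddf_unit : ddf := Ddf ddf_unit_01 ddf_unit_left.

Lemma ddf_mulC f g : ddf_mul f g = ddf_mul g f.
Proof.
suff h (f' g' : ddf) c : ddf_mul_fun f' g' c <= ddf_mul_fun g' f' c.
  by apply: ddf_eq => c; apply/le_anti/andP; split; exact: h.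
apply: ddf_mul_le; first by case/andP: (ddf_mul_01 g' f' c).
by move=> a b abc; rewrite mulrC; apply: ddf_mul_ub; rewrite addeC.
Qed.

Lemma ddf_mulA_le f g h c :
  ddf_mul f (ddf_mul g h) c <= ddf_mul (ddf_mul f g) h c.
Proof.
apply: ddf_mul_le => [|a b' ab]; first exact: ddf_ge0.
apply: mul_sup_le; [exact: ddf_ge0|exact: ddf_ge0|].
move=> _ [[b d] /= bd <-]; rewrite mulrA.
apply: (@le_trans _ _ (ddf_mul f g (ext0_add a b) * h d)).
  by apply: ler_wpM2r; [exact: ddf_ge0|exact: ddf_mul_ub].
apply: ddf_mul_ub; rewrite /= -addeA; apply: le_trans ab.
exact: leeD.
Qed.

Lemma ddf_mulA f g h : ddf_mul f (ddf_mul g h) = ddf_mul (ddf_mul f g) h.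
Proof.
apply: ddf_eq => c; apply/le_anti/andP; split; first exact: ddf_mulA_le.
rewrite ddf_mulC (ddf_mulC f g) (ddf_mulC g h) (ddf_mulC f).
exact: ddf_mulA_le.
Qed.

Lemma ddf_mul1m f : ddf_mul ddf_unit f = f.
Proof.
apply: ddf_eq => c; apply/le_anti/andP; split.
  apply: ddf_mul_le => [|a b ab]; first exact: ddf_ge0.
  apply: (@le_trans _ _ (f b)).
    by rewrite ler_piMl// ?ddf_ge0 ?ddf_le1.
  by apply: ddf_mono; apply: le_trans ab; rewrite leeDr// (svalP a).
rewrite {1}(ddf_left f c); apply: sup_le0; first exact: ddf_ge0.
move=> _ [b /= bc <-].
have bf : sval b \is a fin_num.
  by rewrite ge0_fin_numE ?(svalP b)// (lt_le_trans bc) ?leey.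
have cb : (0 < sval c - sval b)%E by rewrite sube_gt0.
pose a : E := ext0_mk (ltW cb).
have -> : f b = ddf_unit a * f b by rewrite /= /ddf_unit_fun ext0_eq0 cb mul1r.
by apply: ddf_mul_ub; rewrite /= subeK.
Qed.

Lemma ddf_mul_supl S g : ddf_mul (ddf_sup S) g = ddf_sup [set ddf_mul f g | f in S].
Proof.
apply: ddf_eq => c; apply/le_anti/andP; split.
  apply: ddf_mul_le => [|a b ab]; first exact: ddf_ge0.
  rewrite mulrC; apply: mul_sup_le; [exact: ddf_ge0|exact: ddf_ge0|].
  move=> _ [f Sf <-]; rewrite mulrC.
  apply: (@le_trans _ _ (ddf_mul f g c)); first exact: ddf_mul_ub.
  by apply: ddf_sup_ub; exists f.
apply: sup_le0; first exact: ddf_ge0.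
move=> _ [_ [f Sf <-] <-]; apply: ddf_mul_le => [|a b ab]; first exact: ddf_ge0.
apply: (@le_trans _ _ (ddf_sup S a * g b)); last exact: ddf_mul_ub.
by apply: ler_wpM2r; [exact: ddf_ge0|exact: ddf_sup_ub].
Qed.

Program Definition Delta : quantale :=
  {| qsort := ddf;
     qle := fun f g => forall a, f a <= g a;
     qsup := ddf_sup;
     qmul := ddf_mul;
     qunit := ddf_unit |}.
Next Obligation. by []. Qed.
Next Obligation. by move=> f g fg gf; apply: ddf_eq => a; apply/le_anti/andP. Qed.
Next Obligation. by move=> f g h fg gh a; exact: le_trans (gh a). Qed.
Next Obligation. by move=> S f Sf a; exact: ddf_sup_ub. Qed.
Next Obligation.
move=> S f h a; apply: sup_le0; first exact: ddf_ge0.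
by move=> _ [g Sg <-]; exact: h.
Qed.
Next Obligation. exact: ddf_mulA. Qed.
Next Obligation. exact: ddf_mul1m. Qed.
Next Obligation. by move=> f; rewrite ddf_mulC; exact: ddf_mul1m. Qed.
Next Obligation. exact: ddf_mul_supl. Qed.
Next Obligation.
move=> S g; rewrite ddf_mulC ddf_mul_supl; congr ddf_sup.
by apply: eq_imagel => f _; exact: ddf_mulC.
Qed.

Definition step_fun (a : E) (p : R) : E -> R :=
  fun c => if (sval a < sval c)%E then p else 0.

Lemma step_01 a p : 0 <= p <= 1 -> forall c, 0 <= step_fun a p c <= 1.
Proof. by move=> p01 c; rewrite /step_fun; case: ifP => //; rewrite lexx ler01. Qed.

Lemma step_left a p : 0 <= p <= 1 -> forall c, step_fun a p c =
  sup [set step_fun a p b | b in [set b : E | (sval b < sval c)%E]].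
Proof.
move=> p01; have /andP[p0 _] := p01; apply: mk_left; first exact: step_01.
  move=> x y xy; rewrite /step_fun; case: ifPn => [ax|_].
    by rewrite (lt_le_trans ax xy).
  by case: ifP.
move=> y r r0 h; rewrite /step_fun; case: ifPn => // ay.
have [z az zy] := ext0_dense ay.
by apply: le_trans (h z zy); rewrite /step_fun az.
Qed.

Definition step a p (p01 : 0 <= p <= 1) : ddf := Ddf (step_01 a p01) (step_left a p01).

Lemma Delta_cd : completely_distributive Delta.
Proof.
apply: approx_cd => f b; rewrite ddf_left; set r := (X in _ <= X).
have r0 : 0 <= r by exact: ddf_ge0.
apply: sup_le0 => // _ [a /= ab <-]; rewrite leNgt; apply/negP => rf.
have [rp pf] := midf_lt rf; set p := (r + f a) / 2 in rp pf.
have p01 : 0 <= p <= 1.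
  by rewrite (le_trans r0 (ltW rp)) (le_trans (ltW pf) (ddf_le1 f a)).
suff : p <= r by rewrite leNgt rp.
have -> : p = step a p01 b by rewrite /= /step_fun ab.
apply: ddf_sup_ub => S /= fS.
have pS : p < sup [set g a | g in S] by apply: lt_le_trans (fS a).
have [|_ [g Sg <-] pg] := sup_gt _ pS.
  apply/set0P/negP => /eqP S0; move: pS; rewrite S0 sup0 ltNge.
  by case/andP: p01 => ->.
exists g => // c; rewrite /= /step_fun; case: ifPn => [ac|_]; last exact: ddf_ge0.
by apply: (le_trans (ltW pg)); apply: ddf_mono; exact: ltW.
Qed.

End Distributions.

Definition AppCat (R : realType) : category := VApp (Pplus R).
Definition ProbApp (R : realType) : category := VApp (Delta R).

Definition Top_App (R : realType) : functor Top (AppCat R) :=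
  B_iota (@Pplus_cd R).
Definition Top_ProbApp (R : realType) : functor Top (ProbApp R) :=
  B_iota (@Delta_cd R).

(* Main.v *)
From mathcomp Require Import all_boot all_order all_algebra.
From mathcomp Require Import boolp classical_sets reals.
From mathcomp Require Import constructive_ereal ereal filter topology.
Require Import Defs.

Set Implicit Arguments.
Unset Strict Implicit.
Unset Printing Implicit Defensive.
Import Order.TTheory GRing.Theory Num.Theory.
Local Open Scope classical_set_scope.
Local Open Scope quantale_scope.

(** Complete distributivity makes ultrafilter and closure presentations of a
    structure mutually inverse; for [V = 2] this also shows that an algebra is
    the convergence relation of its topology. All functors fix underlying maps,
    so a pair of adjoint monotone maps between [2] and [V] turns directly into
    an equivalence between "is a morphism" on both sides, i.e. an adjunction.
    Injectivity of [B_iota] on objects holds since [B_pi] inverts it strictly. *)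

Lemma ultra_extend (X : Type) (F : set_system X) :
  ProperFilter F -> exists G : ultra X, F `<=` uset G.
Proof. by move=> /ultraFilterLemma [G [uG FG]]; exists (Ultra uG). Qed.

(** * Total belowness, and the two round trips between closure and ultrafilter structures *)

Section RoundTrips.
Variables (V : quantale) (cd : completely_distributive V).

Lemma totally_below_le (u v : V) : totally_below u v -> u ⊑ v.
Proof. by move=> /(_ [set v]) [|_ -> //]; exact: qsup_ub. Qed.

Lemma totally_below_trans_le (u v w : V) :
  totally_below u v -> v ⊑ w -> totally_below u w.
Proof. by move=> uv vw S wS; apply: uv; exact: qle_trans wS. Qed.

(** Approximating [v] from below twice shows it to be under the supremum of all [t] totally below
    some [w] that is totally below [v]; since [u] is totally below [v], one such [t] lies above
    [u]. *)
Lemma totally_below_interpolate (u v : V) :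
  totally_below u v -> exists2 w, totally_below u w & totally_below w v.
Proof.
move=> uv.
have [|t [w wv tw] ut] :=
    uv [set t | exists2 w, totally_below w v & totally_below t w].
  apply: (qle_trans (cd_approx cd v)); apply: qsup_le => w wv.
  apply: (qle_trans (cd_approx cd w)); apply: qsup_le => t tw.
  by apply: qsup_ub; exists w.
exists w => // S wS; have [s Ss ts] := tw S wS.
by exists s => //; exact: qle_trans ts.
Qed.

(** Testing on the pair [[set v; w]] alone would give only [u ⊑ v] or [u ⊑ w]. Testing an
    interpolated [t] instead keeps [u] totally below the chosen member. *)
Lemma totally_below_join (u v w : V) : totally_below u (qjoin v w) ->
  totally_below u v \/ totally_below u w.
Proof.
move=> /totally_below_interpolate [t ut tvw].
have [|_ [] -> ts] := tvw [set v; w]; first exact: qle_refl.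
  by left; exact: totally_below_trans_le ts.
by right; exact: totally_below_trans_le ts.
Qed.

(* If [u] is totally below [inf_{A in F} c A x], the sets
   [{G | A in G, u <= l G x}] generate an ultrafilter whose Kowalski sum is
   [F]; transitivity against the principal ultrafilter at [x] concludes. *)
Lemma app_of_algK (X : Type) (l : ultra X -> X -> V) :
  is_alg l -> alg_of_app (app_of_alg l) = l.
Proof.
move=> [l1 lT]; apply/funext => F; apply/funext => x; apply: qle_anti.
  set v := alg_of_app _ _ _.
  apply: (qle_trans (cd_approx cd v)); apply: qsup_le => u uv.
  pose base A := [set G : ultra X | G A /\ u ⊑ l G x].
  have base0 A : F A -> base A !=set0.
    move=> FA; have [|_ [G GA <-] uG] := uv [set l G x | G in [set G : ultra X | G A]].
      by apply: qinf_lb; exists A.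
    by exists G.
  have PF : ProperFilter (filter_from (uset F) base).
    apply: filter_from_proper => //; apply: filter_from_filter.
      by exists setT; exact: filterT.
    move=> A B FA FB; exists (A `&` B); first exact: filterI.
    by move=> G [GAB uG]; split; split=> //; apply: filterS GAB => y [].
  have [XX baseXX] := ultra_extend PF.
  have FE : F = usum XX.
    apply: ultraP => A FA; apply: baseXX; exists A => //.
    by move=> G [].
  rewrite FE -[u]qmulm1; apply: (qle_trans _ (lT XX (upoint x) x)).
  apply: qmul_le2 (l1 x); apply: qinf_ge => _ [AA XA [B /principal_filterP Bx <-]].
  have XT : XX (base setT) by apply: baseXX; exists setT => //; exact: filterT.
  have /filter_ex [G [AG [_ uG]]] : XX (AA `&` base setT) by exact: filterI.
  by apply: (qle_trans uG); apply: qsup_ub; exists G => //; exists x.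
apply: qinf_ge => _ [A FA <-]; apply: qsup_ub.
by exists F.
Qed.

Lemma app_of_alg_of_app_le (X : Type) (c : set X -> X -> V) A x :
  app_of_alg (alg_of_app c) A x ⊑ c A x.
Proof. by apply: qsup_le => _ [F FA <-]; apply: qinf_lb; exists A. Qed.

(* For [u] totally below [c A x], the sets [B] with [u] not totally below
   [c B x] form an ideal by interpolation, and [A] is not in it. *)
Lemma alg_of_appK (X : Type) (c : set X -> X -> V) :
  is_app c -> app_of_alg (alg_of_app c) = c.
Proof.
move=> ac; have mono := app_mono ac; have [_ _ c0 cU] := ac.
apply/funext => A; apply/funext => x; apply: qle_anti.
  exact: app_of_alg_of_app_le.
apply: (qle_trans (cd_approx cd _)); apply: qsup_le => u uA.
pose small := [set B | ~ totally_below u (c B x)].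
pose base B := A `\` B.
(* Nothing is totally below the bottom element, the supremum of the empty set. *)
have small0 : small set0.
  by rewrite /small /= c0 => /(_ set0) [] //; exact: qle_refl.
have PF : ProperFilter (filter_from small base).
  apply: filter_from_proper => [|B uB]; first apply: filter_from_filter.
  - by exists set0.
  - move=> B C uB uC; exists (B `|` C); last first.
      by move=> y [Ay nBC]; split; split=> // ?; apply: nBC; [left|right].
    by rewrite /small /= cU => /totally_below_join [].
  - apply: contrapT => /set0P/negP/negPn/eqP AB; apply: uB.
    apply: (totally_below_trans_le uA); apply: mono.
    by rewrite -subset0 in AB => y Ay; apply: contrapT => nB; exact: (AB y).
have [F baseF] := ultra_extend PF.
have FA : F A.
  by apply: baseF; exists set0 => // y [].
have uF : u ⊑ alg_of_app c F x.
  apply: qinf_ge => _ [B FB <-]; apply: contrapT => uB.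
  have /ultraC : F (~` B).
    by apply: baseF; exists B => [/totally_below_le//|y []].
  exact.
by apply: (qle_trans uF); apply: qsup_ub; exists F.
Qed.

Lemma app_homP_alg (X Y : Type) (l : ultra X -> X -> V) (d : set Y -> Y -> V)
    (f : X -> Y) : is_alg l -> is_app d ->
  is_app_hom (app_of_alg l) d f <-> is_alg_hom l (alg_of_app d) f.
Proof.
move=> al ad; split=> [/(alg_of_app_hom ad)|/app_of_alg_hom].
  by rewrite app_of_algK.
by rewrite alg_of_appK.
Qed.

Lemma alg_homP_app (X Y : Type) (c : set X -> X -> V) (m : ultra Y -> Y -> V)
    (f : X -> Y) : is_app c -> is_alg m ->
  is_app_hom c (app_of_alg m) f <-> is_alg_hom (alg_of_app c) m f.
Proof.
move=> ac am; split=> [/(alg_of_app_hom (app_of_alg_is_app cd am))|/app_of_alg_hom].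
  by rewrite app_of_algK.
by rewrite alg_of_appK.
Qed.

End RoundTrips.

(** * Topologies as algebras over [two] *)

Lemma two_cd : completely_distributive two.
Proof.
apply: approx_cd => -[] // _; apply/asboolP => S /(_ isT)/asboolP St.
by exists true.
Qed.

(* The complement of the closure of [A] is open because closure, being the
   approach structure of the algebra, is idempotent. *)
Lemma alg_of_top_of_alg (X : alg two) :
  @alg_of_top (top_of_alg X) = @alg_l two X.
Proof.
have aX := @alg_ax two X; have aC := app_of_alg_is_app two_cd aX.
apply/funext => F; apply/funext => x; apply/idP/idP; last first.
  by move=> lF; apply/alg_of_topP => U oU Ux; exact: (oU : alg_open _ U) lF Ux.
move=> /alg_of_topP cvF; rewrite -(app_of_algK two_cd aX).
apply/two_infP => _ [A FA <-]; apply: contrapT => ncA.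
set c := app_of_alg (@alg_l two X) in aC ncA.
pose U : set X := [set y | ~ c A y].
have [c1 cT _ _] := aC.
have oU : alg_open (@alg_l two X) U.
  move=> G y lG Uy; apply: contrapT => /(ultraC G U).1 GU.
  have := cT [set A] (~` U) y; rewrite bigcup_set1 => cAA.
  apply/Uy/cAA/andP; split.
    apply/two_infP => _ [z /contrapT cz <-]; apply/asboolP.
    by exists A.
  by apply/asboolP; exists G.
have FU : F U by exact: cvF oU ncA.
have /filter_ex [y [Ay]] : F (A `&` U) by exact: filterI.
apply; apply: (app_mono aC) (c1 y isT) => _ -> //.
Qed.

(** If [U] is not a neighbourhood of its point [x], the sets [A \ U] with [A] a neighbourhood of [x]
    generate a proper filter. An ultrafilter extending it converges to [x] but misses [U]. *)
Lemma alg_open_alg_of_top (T : topologicalType) (U : set T) :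
  alg_open (@alg_of_top T) U <-> open U.
Proof.
split=> [oU|oU F x /alg_of_topP Fx Ux]; last exact: Fx.
rewrite openE => x Ux; apply: contrapT => nU.
have PF : ProperFilter (filter_from (nbhs x) (fun A => A `\` U)).
  apply: filter_from_proper => [|A xA]; first apply: filter_from_filter.
  - by exists setT; exact: filterT.
  - move=> A B xA xB; exists (A `&` B); first exact: filterI.
    by move=> y [[Ay By] nUy].
  - apply: contrapT => /set0P/negP/negPn/eqP; rewrite -subset0 => AU; apply: nU.
    by apply: filterS xA => y Ay; apply: contrapT => nUy; exact: (AU y).
have [F baseF] := ultra_extend PF.
have /ultraC : F (~` U).
  by apply: baseF; exists setT; [exact: filterT|move=> y []].
apply; apply: oU Ux; apply/asboolP => A xA; apply: baseF.
by exists A => // y [].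
Qed.

Lemma continuousP_alg_hom (S T : topologicalType) (f : S -> T) :
  continuous f <-> is_alg_hom (@alg_of_top S) (@alg_of_top T) f.
Proof.
split=> [|fh]; first exact: continuous_alg_hom.
apply/continuousP => U /alg_open_alg_of_top oU; apply/alg_open_alg_of_top.
by move=> F x Fx Ufx; exact: oU (fh F x Fx) Ufx.
Qed.

(** Injectivity on objects asks for equal packed structures, not just homeomorphic spaces. Open sets
    are determined by neighbourhoods through [oE], and the other topological fields are proofs. *)
Lemma topological_eq (T : Type) (c d : Topological.axioms_ T) :
  Topological.choice_hasChoice_mixin c = Topological.choice_hasChoice_mixin d ->
  Topological.eqtype_hasDecEq_mixin c = Topological.eqtype_hasDecEq_mixin d ->
  isFiltered.nbhs (Topological.filter_isFiltered_mixin c) =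
  isFiltered.nbhs (Topological.filter_isFiltered_mixin d) ->
  Topological.Pack c = Topological.Pack d.
Proof.
case: c d => [ch eq [] [n] [o pf nb oE]] [ch' eq' [] [n'] [o' pf' nb' oE']] /=.
move=> cE eE nE; subst ch' eq' n'.
have opE : o = o' by rewrite oE oE'.
move: nb' oE'; rewrite -opE => nb' oE'.
rewrite (Prop_irrelevance pf pf') (Prop_irrelevance nb nb').
by rewrite (Prop_irrelevance oE oE').
Qed.

Lemma top_of_alg_of_top (T : topologicalType) :
  top_of_alg (Alg (@alg_of_top_is_alg T)) = T :> topologicalType.
Proof.
pose T' : topologicalType := top_of_alg (Alg (@alg_of_top_is_alg T)).
have nE : (fun x : T' => nbhs x) = (fun x : T => nbhs x).
  apply/funext => x; apply/funext => A; apply/propext.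
  rewrite [in X in X <-> _]nbhsE [in X in _ <-> X]nbhsE.
  by split=> -[U [oU Ux] UA]; exists U => //; split=> //;
    exact/alg_open_alg_of_top.
(* [top_of_alg] inherits carrier, equality and choice from [T], so these agree by [erefl] and only
   neighbourhoods are compared. *)
case: T @T' nE => T c T' nE.
exact: (@topological_eq T (Topological.class T') c erefl erefl nE).
Qed.

Lemma left_adjoint_of_equiv (C D : category) (F : functor C D) (G : functor D C)
    (phi : forall (A : C) (B : D), hom (F A) B -> hom A (G B))
    (psi : forall (A : C) (B : D), hom A (G B) -> hom (F A) B) :
  (forall A B, cancel (phi A B) (psi A B)) ->
  (forall A B, cancel (psi A B) (phi A B)) ->
  (forall (A A' : C) (B B' : D) (a : hom A' A) (b : hom B B')
      (g : hom (F A) B),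
    phi A' B' (cmp b (cmp g (fhom F a))) =
    cmp (fhom G b) (cmp (phi A B g) a)) ->
  left_adjoint F G.
Proof. by move=> pK qK nat; exists phi; split=> // A B; exists (psi A B). Qed.

Lemma alg_eq (V : quantale) (X : choiceType) (l m : ultra X -> X -> V)
    (al : is_alg l) (am : is_alg m) : l = m -> Alg al = Alg am.
Proof. by move=> lm; subst m; congr Alg; exact: Prop_irrelevance. Qed.

(** * The adjunctions between [Top] and [VApp V] *)

Section TopInVApp.
Variables (V : quantale) (cd : completely_distributive V).

Lemma galois_iota_pi : galois (iota_map V) (@pi_map V).
Proof.
move=> [] v; split=> [h|h] //=; last exact: qbot_le.
  by move=> _; exact/asboolP.
by have /asboolP := h isT.
Qed.

(** Since [o_map v ⊑ true] always holds, the adjunction forces [v ⊑ qunit] for every [v]; this is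
    where integrality enters. *)
Lemma galois_o_iota : integral V -> galois (@o_map V) (iota_map V).
Proof.
move=> iV v [] /=; split=> // h; rewrite ?/iota_map.
- by rewrite iV; exact: qtop_ge.
- apply: contrapT => nv; suff /h : is_true (o_map v) by [].
  by apply/asboolP => v0; apply: nv; rewrite v0; exact: qle_refl.
- by move=> /asboolP []; exact: qle_anti h (qbot_le _).
Qed.

(** If [qunit] were [qbot], [iota_map] would be constant. Fullness and injectivity on objects both
    rest on this reflection of order. *)
Lemma iota_le_reflect (a b : two) : @qunit V <> qbot V ->
  iota_map V a ⊑ iota_map V b -> a ⊑ b.
Proof.
move=> nt; case: a b => [] [] // kb; exfalso; apply: nt.
exact: qle_anti kb (qbot_le _).
Qed.

Lemma coreflection_hom (T : topologicalType) (Y : app V) (f : T -> Y) :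
  is_app_hom (@app_c V (B_iota cd T)) (@app_c V Y) f <->
  continuous (f : T -> B_pi cd Y).
Proof.
rewrite continuousP_alg_hom alg_of_top_of_alg.
rewrite (app_homP_alg cd _ (@iota_pres V _ _ (@alg_of_top_is_alg T)) (@app_ax V Y)).
by split=> fh F x; apply/galois_iota_pi; exact: fh.
Qed.

(** From right to left, the adjunction is applied pointwise after [alg_bar_ge]. From left to right,
    the structure of [T] pulled back along [f] is an algebra above [o_map] of that of [X], so it
    dominates the least one. *)
Lemma reflection_hom (X : app V) (T : topologicalType) (f : X -> T) :
  integral V ->
  is_app_hom (@app_c V X) (@app_c V (B_iota cd T)) f <->
  continuous (f : Bbar_o cd X -> T).
Proof.
move=> iV; rewrite continuousP_alg_hom alg_of_top_of_alg.
rewrite (alg_homP_app cd _ (@app_ax V X) (@iota_pres V _ _ (@alg_of_top_is_alg T))).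
split=> fh; last first.
  move=> F x; apply/(galois_o_iota iV); apply: (qle_trans _ (fh F x)).
  exact: alg_bar_ge.
apply: alg_bar_least; first exact/alg_pullback/alg_of_top_is_alg.
by move=> F x; apply/(galois_o_iota iV); exact: fh.
Qed.

Lemma B_iota_full : @qunit V <> qbot V -> full (B_iota cd).
Proof.
move=> nt S T [g gP]; have : continuous (g : S -> T).
  apply/continuousP_alg_hom => F x; apply: (iota_le_reflect nt).
  move: gP => /(app_homP_alg cd _ (@iota_pres V _ _ (@alg_of_top_is_alg S)) (app_ax _)).
  by rewrite /= (app_of_algK cd (@iota_pres V _ _ (@alg_of_top_is_alg T))); exact.
by move=> gc; exists (exist _ (g : S -> T) gc); exact: eq_exist.
Qed.

Lemma pi_iota (b : two) : @qunit V <> qbot V -> pi_map (iota_map V b) = b.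
Proof.
move=> nt; apply: (@qle_anti two); last first.
  by apply/galois_iota_pi; exact: qle_refl.
apply: (iota_le_reflect nt); apply/galois_iota_pi; exact: qle_refl.
Qed.

Lemma B_pi_iota (T : Top) : @qunit V <> qbot V ->
  B_pi cd (B_iota cd T) = T.
Proof.
move=> nt; rewrite -[RHS]top_of_alg_of_top.
apply: (congr1 (fobj TopOfAlg)); apply: alg_eq => /=.
rewrite (app_of_algK cd (@iota_pres V _ _ (@alg_of_top_is_alg T))).
by apply/funext => F; apply/funext => x; exact: pi_iota.
Qed.

Lemma B_iota_embedding : @qunit V <> qbot V -> embedding (B_iota cd).
Proof.
move=> nt; split.
  by apply: (can_inj (g := B_pi cd)) => T; exact: B_pi_iota.
move=> S T [f fP] [g gP] /(congr1 sval) /= fg; exact: eq_exist.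
Qed.

Lemma B_pi_coreflector : coreflector (B_iota cd) (B_pi cd).
Proof.
pose phi (T : Top) (Y : VApp V) (g : hom (B_iota cd T) Y) : hom T (B_pi cd Y) :=
  exist _ (sval g) ((coreflection_hom _).1 (svalP g)).
pose psi (T : Top) (Y : VApp V) (g : hom T (B_pi cd Y)) : hom (B_iota cd T) Y :=
  exist _ (sval g) ((coreflection_hom _).2 (svalP g)).
apply: (left_adjoint_of_equiv (phi := phi) (psi := psi)).
- by move=> A B [f fP]; exact: eq_exist.
- by move=> A B [f fP]; exact: eq_exist.
- by move=> *; exact: eq_exist.
Qed.

Lemma Bbar_o_reflector : integral V -> reflector (B_iota cd) (Bbar_o cd).
Proof.
move=> iV.
pose phi (X : VApp V) (T : Top) (g : hom (Bbar_o cd X) T) : hom X (B_iota cd T) :=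
  exist _ (sval g) ((reflection_hom _ iV).2 (svalP g)).
pose psi (X : VApp V) (T : Top) (g : hom X (B_iota cd T)) : hom (Bbar_o cd X) T :=
  exist _ (sval g) ((reflection_hom _ iV).1 (svalP g)).
apply: (left_adjoint_of_equiv (phi := phi) (psi := psi)).
- by move=> A B [f fP]; exact: eq_exist.
- by move=> A B [f fP]; exact: eq_exist.
- by move=> *; exact: eq_exist.
Qed.

Lemma B_iota_full_reflective : @qunit V <> qbot V -> integral V ->
  full_reflective (B_iota cd).
Proof.
move=> nt iV; split; [exact: B_iota_full|exact: B_iota_embedding|].
by exists (Bbar_o cd); exact: Bbar_o_reflector.
Qed.

Lemma B_iota_full_coreflective : @qunit V <> qbot V ->
  full_coreflective (B_iota cd).
Proof.
move=> nt; split; [exact: B_iota_full|exact: B_iota_embedding|].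
by exists (B_pi cd); exact: B_pi_coreflector.
Qed.

End TopInVApp.

(** * Nontriviality and integrality of the two concrete quantales *)

Section Instances.
Variable R : realType.

Lemma Pplus_nontrivial : @qunit (Pplus R) <> qbot (Pplus R).
(* In the reversed order the bottom is the infimum of the empty set, [+oo], whereas the unit is
   [0]. *)
Proof. by move=> /(congr1 sval); rewrite /= /ext0_inf_val image_set0 ereal_inf0. Qed.

Lemma Pplus_integral : integral (Pplus R).
Proof.
apply: qle_anti; first exact: qtop_ge.
by apply: qsup_le => u _; exact: (svalP u).
Qed.

Lemma Delta_nontrivial : @qunit (Delta R) <> qbot (Delta R).
Proof.
(* At [+oo] the unit takes the value 1 and the bottom the value [sup set0], which is 0. *)
move=> /(congr1 (fun f : ddf R => f (ext0_mk (leey 0)))) /=.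
rewrite /ddf_unit_fun /ddf_sup_fun /= image_set0 sup0 => /eqP.
by rewrite oner_eq0.
Qed.

Lemma Delta_integral : integral (Delta R).
Proof.
apply: qle_anti; first exact: qtop_ge.
apply: qsup_le => f _ a /=; rewrite /ddf_unit_fun; case: ifPn => [/eqP a0|_].
  (* At 0 left continuity forces the value 0, because the supremum runs over the empty set. *)
  rewrite ddf_left a0 [X in sup X](_ : _ = set0) ?sup0//.
  by rewrite -subset0 => _ [b /= + _]; rewrite ltNge (svalP b).
exact: ddf_le1.
Qed.

End Instances.

Theorem corollary4p6 :
  (forall (V : quantale) (cd : completely_distributive V)
      (nontrivial : @qunit V <> qbot V),
    [/\ galois (iota_map V) (@pi_map V),
        full (B_iota cd),
        embedding (B_iota cd),
        coreflector (B_iota cd) (B_pi cd) &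
        integral V ->
          galois (@o_map V) (iota_map V) /\
          reflector (B_iota cd) (Bbar_o cd)]) /\
  (forall R : realType,
    [/\ full_reflective (Top_App R),
        full_coreflective (Top_App R),
        full_reflective (Top_ProbApp R) &
        full_coreflective (Top_ProbApp R)]).
Proof.
split=> [V cd nt|R].
  split.
  - exact: galois_iota_pi.
  - exact: B_iota_full.
  - exact: B_iota_embedding.
  - exact: B_pi_coreflector.
  - by move=> iV; split; [exact: galois_o_iota|exact: Bbar_o_reflector].
split.
- exact: B_iota_full_reflective (@Pplus_nontrivial R) (@Pplus_integral R).
- exact: B_iota_full_coreflective (@Pplus_nontrivial R).
- exact: B_iota_full_reflective (@Delta_nontrivial R) (@Delta_integral R).
- exact: B_iota_full_coreflective (@Delta_nontrivial R).
Qed.
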